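(* Let $\succsim_1$ and $\succsim_2$ be two IB preferences on $\mathcal F$, with corresponding utility indices $u_i$ and families $\mathscr{P}_i^*$ and $\mathscr{Q}_i^*$ ($i=1,2$). Then the following conditions are equivalent: (i) $\succsim_1$ is more ambiguity averse than $\succsim_2$; (ii) $u_1\approx u_2$ and $\mathscr{P}_1^*\subseteq\mathscr{P}_2^*$ (provided $u_1=u_2$); (iii) $u_1\approx u_2$ and $\mathscr{Q}_1^*\supseteq\mathscr{Q}_2^*$ (provided $u_1=u_2$). Here $u_1\approx u_2$ means that $u_1$ and $u_2$ are positive affine transformations of each other, and ''provided $u_1=u_2$'' means that the inclusion is asserted for the families computed with the same normalization $u_1=u_2$ of the utility index.
   Context: Setting. $S$ is a nonempty set, $\Sigma$ an algebra of subsets of $S$, $X$ a nonempty convex subset of a real vector space. $\mathcal{F}$ is the set of simple acts: $\Sigma$-measurable maps $f:S\to X$ with finitely many values. Each $x\in X$ is identified with the constant act equal to $x$. Mixtures are defined statewise. For $u:X\to\mathbb{R}$ and $f\in\mathcal F$, $u(f)$ is the function $s\mapsto u(f(s))$. $\Delta$ is the set of finitely additive probabilities on $\Sigma$, with the weak* topology $\sigma(\Delta,B_0(\Sigma))$, where $B_0(\Sigma)$ is the space of real-valued $\Sigma$-measurable functions on $S$ with finitely many values. For a binary relation $\succsim$ on $\mathcal F$, $\sim$ and $\succ$ are its symmetric and asymmetric parts. $\succsim$ is an invariant biseparable (IB) preference if it satisfies: A1 (Weak Order): $\succsim$ is nontrivial ($f\succ g$ for some $f,g\in\mathcal F$), complete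 and transitive. A2 (Monotonicity): if $f(s)\succsim g(s)$ for all $s\in S$, then $f\succsim g$. A3 (Archimedean): if $f\succ g\succ h$ there are $\alpha,\beta\in(0,1)$ with $\alpha f+(1-\alpha)h\succ g\succ\beta f+(1-\beta)h$. A7 (C-Independence): for all $f,g\in\mathcal F$, $x\in X$, $\alpha\in(0,1)$: $f\succsim g\iff\alpha f+(1-\alpha)x\succsim\alpha g+(1-\alpha)x$. Representation. For every IB preference $\succsim$ there are a nonconstant affine $u:X\to\mathbb R$ (the utility index, unique up to positive affine transformations) and a family $\mathscr P$ of nonempty convex compact subsets of $\Delta$ such that $f\succsim g$ iff $\max_{P\in\mathscr P}\min_{p\in P}\int u(f)dp\ge\max_{P\in\mathscr P}\min_{p\in P}\int u(g)dp$; and, for the same $u$, a family $\mathscr Q$ of nonempty convex compact subsets of $\Delta$ such that $f\succsim g$ iff $\min_{Q\in\mathscr Q}\max_{q\in Q}\int u(f)dq\ge\min_{Q\in\mathscr Q}\max_{q\in Q}\int u(g)dq$. Given $u$, the largest such families are $$\mathscr P^*=\{P\subseteq\Delta\mid P\text{ convex, compact},\ \min_{p\in P}\textstyle\int u(f)dp\le u(x_f)\ \forall f\in\mathcal F\},$$ $$\mathscr Q^*=\{Q\subseteq\Delta\mid Q\text{ convex, compact},\ \max_{q\in Q}\textstyle\int u(f)dq\ge u(x_f)\ \forall f\in\mathcal F\}$$ (members nonempty), where $x_f\in X$ is a certainty equivalent of $f$, i.e. $x_f\sim f$. $\mathscr P_i^*,\mathscr Q_i^*$ are these families for $\succsim_i$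 and $u_i$. $\succsim_1$ is more ambiguity averse than $\succsim_2$ if, for all $f\in\mathcal F$ and $x\in X$, $x\succsim_2 f$ implies $x\succsim_1 f$. *)

(* Defs.v *)
From HB Require Import structures.
From mathcomp Require Import all_boot all_order all_algebra.
From mathcomp Require Import all_classical all_reals all_analysis.

Set Implicit Arguments.
Unset Strict Implicit.
Unset Printing Implicit Defensive.

Import Order.TTheory GRing.Theory Num.Theory.
Import numFieldNormedType.Exports.

Local Open Scope classical_set_scope.
Local Open Scope ring_scope.

Definition is_min (R : realType) (A : set R) (m : R) : Prop :=
  A m /\ lbound A m.

Definition is_max (R : realType) (A : set R) (m : R) : Prop :=
  A m /\ ubound A m.

Section acts.
Context {d : measure_display} {S : algebraOfSetsType d} {R : realType}.

(* Measurable maps with finitely many values.  As the range is finite,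
   measurability amounts to measurability of the fibres, which makes sense even
   when the codomain [T] carries no sigma-algebra. *)
Definition simple {T : Type} (f : S -> T) : Prop :=
  finite_set (range f) /\ forall y, measurable (f @^-1` [set y]).

Definition B0 : set (S -> R) := [set phi | simple phi].

Context {E : lmodType R}.

(* A preference is a relation on [S -> E]; only its restriction to the acts
   with values in [X] is ever used. *)
Definition act (X : set E) : set (S -> E) :=
  [set f | simple f /\ forall s, X (f s)].

Definition mix (a : R) (f g : S -> E) : S -> E :=
  fun s => a *: f s + (1 - a) *: g s.

Implicit Type pref : (S -> E) -> (S -> E) -> Prop.

Definition strict pref f g : Prop := pref f g /\ ~ pref g f.

Definition indiff pref f g : Prop := pref f g /\ pref g f.

Definition weak_order (X : set E) pref : Prop :=
  [/\ exists f g, [/\ act X f, act X g & strict pref f g],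
      forall f g, act X f -> act X g -> pref f g \/ pref g f
    & forall f g h, act X f -> act X g -> act X h ->
        pref f g -> pref g h -> pref f h].

Definition monotone_pref (X : set E) pref : Prop :=
  forall f g, act X f -> act X g ->
    (forall s, pref (cst (f s)) (cst (g s))) -> pref f g.

Definition archimedean_pref (X : set E) pref : Prop :=
  forall f g h, act X f -> act X g -> act X h ->
    strict pref f g -> strict pref g h ->
    exists a b : R, [/\ 0 < a < 1, 0 < b < 1,
      strict pref (mix a f h) g & strict pref g (mix b f h)].

Definition C_independence (X : set E) pref : Prop :=
  forall f g x (a : R), act X f -> act X g -> X x -> 0 < a < 1 ->
    pref f g <-> pref (mix a f (cst x)) (mix a g (cst x)).

Definition invariant_biseparable (X : set E) pref : Prop :=
  [/\ weak_order X pref, monotone_pref X pref, archimedean_pref X pref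
    & C_independence X pref].

Definition more_ambiguity_averse (X : set E) pref1 pref2 : Prop :=
  forall f x, act X f -> X x -> pref2 (cst x) f -> pref1 (cst x) f.

(* Utilities are functions on [E] of which only the restriction to [X]
   matters. *)
Definition affine_on (X : set E) (u : E -> R) : Prop :=
  forall x y (a : R), X x -> X y -> 0 <= a <= 1 ->
    u (a *: x + (1 - a) *: y) = a * u x + (1 - a) * u y.

Definition nonconstant_on (X : set E) (u : E -> R) : Prop :=
  exists x y, [/\ X x, X y & u x != u y].

Definition pos_affine_equiv (X : set E) (u v : E -> R) : Prop :=
  exists a b : R, 0 < a /\ forall x, X x -> u x = a * v x + b.

End acts.

Section charges.
Context {d : measure_display} {S : algebraOfSetsType d} {R : realType}.

(* Set functions are total on [set S]; a charge is set to 0 outside the algebra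
   so that it is determined by its values on measurable sets.  The codomain is
   [R^o], i.e. [R] as a vector space over itself, so that set functions form an
   [lmodType R]. *)
Definition Delta : set (set S -> R^o) :=
  [set p | [/\ forall A, 0 <= p A :> R,
               p [set: S] = 1,
               forall A B, measurable A -> measurable B -> A `&` B = set0 ->
                 p (A `|` B) = p A + p B
             & forall A, ~ measurable A -> p A = 0]].

(* Only meant for [phi] in [B0]. *)
Definition charge_integral (p : set S -> R^o) (phi : S -> R) : R :=
  \sum_(x \in range phi) x * p (phi @^-1` [set x]).

Definition charge_integral_on_B0 (p : set S -> R^o) :
    prod_topology (fun _ : set_type (@B0 d S R) => R^o) :=
  fun phi => charge_integral p (set_val phi).

(* The coarsest topology that makes [p |-> charge_integral p phi] continuous for every
   [phi] in [B0]; it is put on all set functions and induces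
   sigma(Delta, B0) on [Delta]. *)
Definition weak_star : topologicalType := initial_topology charge_integral_on_B0.

Definition convex_compact (P : set (set S -> R^o)) : Prop :=
  [/\ P `<=` Delta, P !=set0, convex_set P & @compact weak_star P].

Definition charge_integrals (P : set (set S -> R^o)) (phi : S -> R) : set R :=
  [set charge_integral p phi | p in P].

Definition is_maxmin (PP : set (set (set S -> R^o))) (phi : S -> R) (v : R) :=
  is_max [set m | exists2 P, PP P & is_min (charge_integrals P phi) m] v.

Context {E : lmodType R}.
Implicit Type pref : (S -> E) -> (S -> E) -> Prop.

(* Both extrema are required to be attained.  A utility index is defined through
   the max-min representation alone: for an invariant biseparable preference the
   dual min-max representation by the same index is a consequence. *)
Definition utility_index (X : set E) pref (u : E -> R) : Prop :=
  [/\ affine_on X u, nonconstant_on X u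
    & exists PP : set (set (set S -> R^o)), PP `<=` convex_compact /\
        forall f g, act X f -> act X g ->
          exists v w, [/\ is_maxmin PP (u \o f) v, is_maxmin PP (u \o g) w
                         & pref f g <-> w <= v]].

(* [x] ranges over all certainty equivalents of [f]; they have the same utility
   when [u] is a utility index of [pref]. *)
Definition Pstar (X : set E) pref (u : E -> R) : set (set (set S -> R^o)) :=
  [set P | convex_compact P /\
     forall f x, act X f -> X x -> indiff pref (cst x) f ->
       exists2 m, is_min (charge_integrals P (u \o f)) m & m <= u x].

Definition Qstar (X : set E) pref (u : E -> R) : set (set (set S -> R^o)) :=
  [set Q | convex_compact Q /\
     forall f x, act X f -> X x -> indiff pref (cst x) f ->
       exists2 m, is_max (charge_integrals Q (u \o f)) m & u x <= m].

End charges.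

(* Main.v *)
(* Everything reduces to comparing certainty equivalents: [pref1] is more
   ambiguity averse iff [u (x1 f) <= u (x2 f)] for all acts [f], where [xi f] is
   a certainty equivalent of [f] for [prefi].  This comparison clearly yields
   both inclusions.  Conversely, a set attaining the max-min value of [f] lies in
   the first family, which settles [Pstar].  For [Qstar] one needs a member whose
   largest integral of [u \o f] is [u (x f)]: the sublevel set of all charges [q]
   integrating [u \o f] to at most [u (x f)] works, since it meets every set of
   a max-min family, and it is weak* compact by Tychonoff's theorem. *)

Require Import Defs.
From mathcomp Require Import all_boot all_order all_algebra finmap.
From mathcomp Require Import all_classical all_reals all_analysis.
From mathcomp Require Import ring lra.

Set Implicit Arguments.
Unset Strict Implicit.
Unset Printing Implicit Defensive.

Import Order.TTheory GRing.Theory Num.Theory.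
Import numFieldNormedType.Exports.
Local Open Scope classical_set_scope.
Local Open Scope ring_scope.

(** * Affine functions on convex sets, simple maps and extrema *)

Lemma convex_set_mix (R : realType) (E : lmodType R) (X : set E) (x y : E)
    (a : R) :
  convex_set X -> X x -> X y -> 0 <= a <= 1 -> X (a *: x + (1 - a) *: y).
Proof.
move=> cX Xx Xy /andP[a0 a1]; apply: set_mem.
by apply: (cX x y (Itv01 a0 a1)); exact: mem_set.
Qed.

Lemma affine_on_surj (R : realType) (E : lmodType R) (X : set E) (u : E -> R)
    (x y : E) (v : R) :
  convex_set X -> affine_on X u -> X x -> X y -> u x <= v <= u y ->
  exists2 z, X z & u z = v.
Proof.
move=> cX au Xx Xy /andP[xv vy].
have [uyx|uyx] := eqVneq (u y) (u x).
  by exists x => //; apply/eqP; rewrite eq_le xv -uyx vy.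
have xy : 0 < u y - u x by rewrite subr_gt0 lt_neqAle eq_sym uyx (le_trans xv).
pose a := (v - u x) / (u y - u x).
have a01 : 0 <= a <= 1.
  by rewrite /a divr_ge0 ?subr_ge0 ?(le_trans xv)//= ler_pdivrMr // mul1r lerD2r.
exists (a *: y + (1 - a) *: x); first exact: convex_set_mix.
rewrite au// /a; field; exact: lt0r_neq0.
Qed.

Lemma simple_cst d (S : algebraOfSetsType d) T (x : T) :
  simple (cst x : S -> T).
Proof.
split=> [|y]; last first.
  rewrite preimage_cst; case: ifP => _; last exact: measurable0.
  exact: measurableT.
by apply: (sub_finite_set _ (finite_set1 x)) => _ [s _ <-].
Qed.

(** A fibre of [u \o f] is a union of fibres of [f], and finitely many suffice because [f] has
    finite range; so measurability passes to [u \o f] for an arbitrary [u]. *)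
Lemma simple_comp d (S : algebraOfSetsType d) T T' (u : T -> T') (f : S -> T) :
  simple f -> simple (u \o f).
Proof.
move=> [ff mf]; split=> [|y].
  by rewrite -(image_comp f u); exact: finite_image.
have -> : (u \o f) @^-1` [set y] =
    \bigcup_(x in range f `&` u @^-1` [set y]) f @^-1` [set x].
  apply/seteqP; split=> [s /= usy|s [x [_ /= uxy]] /= ->//].
  by exists (f s).
by apply: fin_bigcup_measurable => [|x _]; [exact: finite_setIl|exact: mf].
Qed.

Lemma act_cst (R : realType) d (S : algebraOfSetsType d) (E : lmodType R)
    (X : set E) (x : E) : X x -> act X (cst x : S -> E).
Proof. by move=> Xx; split=> //; exact: simple_cst. Qed.

(** Over an empty [S] all acts coincide, which contradicts nontriviality. A point of [S] makes the
    range of a constant map a singleton, as needed to integrate it. *)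
Lemma weak_order_inhabited (R : realType) d (S : algebraOfSetsType d)
    (E : lmodType R) (X : set E) (pref : (S -> E) -> (S -> E) -> Prop) :
  weak_order X pref -> [set: S] !=set0.
Proof.
move=> [[f [g [_ _ [fg gf]]]] _ _]; apply/set0P/eqP => S0.
have fgE : f = g by apply/funext => s; have : [set: S] s by []; rewrite S0.
by rewrite fgE in fg gf.
Qed.

Lemma is_min_unique (R : realType) (A : set R) m n :
  is_min A m -> is_min A n -> m = n.
Proof.
by move=> [Am mA] [An nA]; apply/eqP; rewrite eq_le mA//= nA.
Qed.

Lemma is_max_unique (R : realType) (A : set R) m n :
  is_max A m -> is_max A n -> m = n.
Proof.
by move=> [Am mA] [An nA]; apply/eqP; rewrite eq_le nA//= mA.
Qed.

(** * Constant acts and certainty equivalents *)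

Lemma charge_integral_cst (R : realType) d (S : algebraOfSetsType d)
    (p : set S -> R^o) (c : R) :
  [set: S] !=set0 -> Delta p -> charge_integral p (cst c) = c.
Proof.
move=> [s _] [_ pT _ _]; rewrite /charge_integral.
have -> : range (cst c : S -> R) = [set c].
  by apply/seteqP; split=> [_ [? _ <-]//|_ ->]; exists s.
rewrite fsbig_set1 preimage_cst ifT ?pT ?mulr1//.
by rewrite inE.
Qed.

Lemma maxmin_cst (R : realType) d (S : algebraOfSetsType d)
    T (u : T -> R) (x : T) (PP : set (set (set S -> R^o))) (v : R) :
  [set: S] !=set0 -> PP `<=` convex_compact ->
  is_maxmin PP (u \o cst x) v -> v = u x.
Proof.
move=> S0 PPc [[P /PPc[PD _ _ _] [[p Pp <-] _]] _].
rewrite (_ : u \o cst x = cst (u x))//.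
by rewrite charge_integral_cst//; exact: PD.
Qed.

Lemma pref_cst (R : realType) d (S : algebraOfSetsType d)
    (E : lmodType R) (X : set E) (pref : (S -> E) -> (S -> E) -> Prop)
    (u : E -> R) (x y : E) :
  weak_order X pref -> utility_index X pref u -> X x -> X y ->
  pref (cst x) (cst y) <-> u y <= u x.
Proof.
move=> /weak_order_inhabited S0 [_ _ [PP [PPc rep]]] Xx Xy.
have [v [w [vx wy ->]]] := rep _ _ (act_cst S Xx) (act_cst S Xy).
by rewrite (maxmin_cst S0 PPc vx) (maxmin_cst S0 PPc wy).
Qed.

(** The two halves of [indiff] bound the max-min value of [f] by [u x] from both sides. The family
    is fixed before [f], so that a set attaining the value of one act can be tested against all
    others. *)
Lemma maxmin_certainty_equivalent (R : realType) d (S : algebraOfSetsType d)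
    (E : lmodType R) (X : set E) (pref : (S -> E) -> (S -> E) -> Prop)
    (u : E -> R) :
  weak_order X pref -> utility_index X pref u ->
  exists2 PP : set (set (set S -> R^o)), PP `<=` convex_compact &
    forall f x, act X f -> X x -> indiff pref (cst x) f ->
      is_maxmin PP (u \o f) (u x).
Proof.
move=> WO U; have S0 := weak_order_inhabited WO.
have [_ _ [PP [PPc rep]]] := U; exists PP => // f x af Xx [xf fx].
have ax := act_cst S Xx.
have [v [w [vx wf /iffLR/(_ xf) wv]]] := rep _ _ ax af.
have [w' [v' [wf' vx' /iffLR/(_ fx) vw]]] := rep _ _ af ax.
rewrite (maxmin_cst S0 PPc vx) in wv.
rewrite (maxmin_cst S0 PPc vx') (is_max_unique wf' wf) in vw.
suff <- : w = u x by [].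
by apply/eqP; rewrite eq_le wv.
Qed.

Lemma compact_has_min (T : topologicalType) (R : realType) (f : T -> R)
    (A : set T) :
  A !=set0 -> compact A -> continuous f -> exists m, is_min (f @` A) m.
Proof.
move=> A0 cA cf.
have [c /set_mem Ac cmin] := compact_EVT_min A0 cA (continuous_subspaceT cf).
exists (f c); split; first by exists c.
by move=> _ [t At <-]; exact/cmin/mem_set.
Qed.

Lemma compact_has_max (T : topologicalType) (R : realType) (f : T -> R)
    (A : set T) :
  A !=set0 -> compact A -> continuous f -> exists m, is_max (f @` A) m.
Proof.
move=> A0 cA cf.
have [c /set_mem Ac cmax] := compact_EVT_max A0 cA (continuous_subspaceT cf).
exists (f c); split; first by exists c.
by move=> _ [t At <-]; exact/cmax/mem_set.
Qed.

(** By monotonicity [f] lies between its worst and its best value taken as constant acts, so its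
    max-min value lies between their utilities; the affine [u] reaches it on the segment joining
    them. *)
Lemma certainty_equivalent_exists (R : realType) d (S : algebraOfSetsType d)
    (E : lmodType R) (X : set E) (pref : (S -> E) -> (S -> E) -> Prop)
    (u : E -> R) (f : S -> E) :
  convex_set X -> weak_order X pref -> monotone_pref X pref ->
  utility_index X pref u -> act X f ->
  exists2 x, X x & indiff pref (cst x) f.
Proof.
move=> cX WO mono U af.
have [sf Xf] := af; have [[s0 _] [fr _]] := (weak_order_inhabited WO, sf).
have r0 : range (u \o f) !=set0 by exists (u (f s0)), s0.
(* A finite range is compact, so the extreme value lemmas for the identity give states [s1] and [s2]
   where [u \o f] is least and greatest. *)
have cr : compact (range (u \o f)).
  by apply: finite_compact; rewrite -(image_comp f u); exact: finite_image.
have cid : continuous (idfun : R -> R) by move=> x; exact: cvg_id.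
have [_ [[_ [s1 _ <-] <-] lo]] := compact_has_min r0 cr cid.
have [_ [[_ [s2 _ <-] <-] hi]] := compact_has_max r0 cr cid.
have ulo s : u (f s1) <= u (f s) by apply: lo; exists (u (f s)) => //; exists s.
have uhi s : u (f s) <= u (f s2) by apply: hi; exists (u (f s)) => //; exists s.
have flo : pref f (cst (f s1)).
  apply: mono => // [|s]; first exact: act_cst.
  exact/(pref_cst WO U (Xf s) (Xf s1)).
have fhi : pref (cst (f s2)) f.
  apply: mono => // [|s]; first exact: act_cst.
  exact/(pref_cst WO U (Xf s2) (Xf s)).
have S0 := weak_order_inhabited WO.
have [au _ [PP [PPc rep]]] := U.
(* Comparing [f] with itself serves only to produce its max-min value [v]. *)
have [v [w [vf wf _]]] := rep _ _ af af.
have vE : w = v by exact: is_max_unique wf vf.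
have [v1 [w1 [v1f w1x /iffLR/(_ flo) w1v1]]] := rep _ _ af (act_cst S (Xf s1)).
have [v2 [w2 [v2x w2f /iffLR/(_ fhi) w2v2]]] := rep _ _ (act_cst S (Xf s2)) af.
rewrite (maxmin_cst S0 PPc w1x) (is_max_unique v1f vf) in w1v1.
rewrite (maxmin_cst S0 PPc v2x) (is_max_unique w2f vf) in w2v2.
have [|x Xx xv] := affine_on_surj (v := v) cX au (Xf s1) (Xf s2).
  by rewrite w1v1.
exists x => //; have ax := act_cst S Xx; split.
  have [a [b [ax' bf ->]]] := rep _ _ ax af.
  by rewrite (maxmin_cst S0 PPc ax') (is_max_unique bf vf) xv.
have [a [b [af' bx ->]]] := rep _ _ af ax.
by rewrite (maxmin_cst S0 PPc bx) (is_max_unique af' vf) xv.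
Qed.

(** * Affine functions that order points alike *)

Lemma affine_on_collinear (R : realType) (E : lmodType R) (X : set E)
    (u v : E -> R) (x y z : E) :
  convex_set X -> affine_on X u -> affine_on X v ->
  (forall a b, X a -> X b -> v b <= v a -> u b <= u a) ->
  X x -> X y -> X z -> v x <= v y <= v z ->
  (u y - u x) * (v z - v x) = (u z - u x) * (v y - v x).
Proof.
move=> cX au av vu Xx Xy Xz /andP[xy yz].
(* The order hypothesis, used both ways, makes [u] a function of [v]. *)
have uE a b : X a -> X b -> v a = v b -> u a = u b.
  by move=> Xa Xb ab; apply/eqP; rewrite eq_le !vu ?ab.
have [zx|zx] := eqVneq (v z) (v x).
  have yx : v y = v x by apply/eqP; rewrite eq_le xy -zx yz.
  by rewrite yx zx !subrr !mulr0.
have xz : 0 < v z - v x.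
  by rewrite subr_gt0 lt_neqAle eq_sym zx (le_trans xy).
pose a := (v y - v x) / (v z - v x).
have a01 : 0 <= a <= 1.
  by rewrite /a divr_ge0 ?subr_ge0 ?(le_trans xy)//= ler_pdivrMr// mul1r lerD2r.
have aE : a * (v z - v x) = v y - v x by rewrite /a divfK// lt0r_neq0.
(* The weight [a] is chosen so that the mixture of [z] and [x] has the same [v] as [y]; by [uE] it
   also has the same [u]. *)
have -> : u y = a * u z + (1 - a) * u x.
  rewrite -au//; apply: uE => //; first exact: convex_set_mix.
  by rewrite av//; lra.
by rewrite -aE; ring.
Qed.

Lemma order_preserving_affine (R : realType) (E : lmodType R) (X : set E)
    (u v : E -> R) :
  convex_set X -> affine_on X u -> affine_on X v -> nonconstant_on X u ->
  (forall a b, X a -> X b -> v b <= v a -> u b <= u a) ->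
  pos_affine_equiv X u v.
Proof.
move=> cX au av nu vu.
have {nu} [x0 [x1 [X0 X1 u01]]] : exists x0 x1, [/\ X x0, X x1 & u x0 < u x1].
  have [x [y [Xx Xy]]] := nu; rewrite neq_lt => /orP[?|?]; first by exists x, y.
  by exists y, x.
have v01 : v x0 < v x1.
  by rewrite ltNge; apply: contraTN u01 => /(vu _ _ X0 X1); rewrite leNgt.
have col := affine_on_collinear cX au av vu.
have du : 0 < u x1 - u x0 by rewrite subr_gt0.
have dv : 0 < v x1 - v x0 by rewrite subr_gt0.
pose a := (u x1 - u x0) / (v x1 - v x0).
exists a, (u x0 - a * v x0); split=> [|x Xx]; first by rewrite divr_gt0.
(* [E0] says that the point [(v x, u x)] lies on the line through the points given by [x0] and [x1],
   whose slope is [a]. *)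
suff E0 : (u x - u x0) * (v x1 - v x0) = (u x1 - u x0) * (v x - v x0).
  suff : u x - u x0 = a * (v x - v x0) by lra.
  by rewrite /a mulrAC -E0 mulfK// lt0r_neq0.
(* Collinearity is available for triples increasing in [v], so [x] may fall between, above or below
   [x0] and [x1]; the last two cases rearrange to [E0]. *)
have [x0x|/ltW xx0] := leP (v x0) (v x).
  have [xx1|/ltW x1x] := leP (v x) (v x1); first by apply: col; rewrite ?x0x.
  have := col _ _ _ X0 X1 Xx; rewrite (ltW v01) x1x => /(_ isT); lra.
have := col _ _ _ Xx X0 X1; rewrite (ltW v01) xx0 => /(_ isT); lra.
Qed.

(** * Weak* topology: continuity of integrals, compactness and convexity of sublevel sets *)

Lemma charge_integralE (R : realType) d (S : algebraOfSetsType d)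
    (p : set S -> R^o) (phi : S -> R) :
  simple phi ->
  charge_integral p phi =
  \sum_(x <- fset_set (range phi)) x * p (phi @^-1` [set x]).
Proof. by move=> [fr _]; rewrite /charge_integral fsbig_finite. Qed.

Lemma charge_integral_continuous (R : realType) d (S : algebraOfSetsType d)
    (phi : S -> R) :
  simple phi ->
  continuous (fun p : weak_star => charge_integral p phi : R).
Proof.
move=> sphi p.
have phiB : phi \in @B0 d S R by rewrite inE.
pose i : set_type (@B0 d S R) := exist _ phi phiB.
apply: (@continuous_comp weak_star _ _ charge_integral_on_B0 (proj i)).
  exact: initial_continuous.
exact: proj_continuous.
Qed.

(** For a fixed simple [phi] the integral is a finite linear combination of evaluations of [p]. The
    pointwise topology is the one to which Tychonoff's theorem applies. *)
Lemma charge_integral_ptws_continuous (R : realType) d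
    (S : algebraOfSetsType d) (phi : S -> R) :
  simple phi ->
  continuous (fun p : {ptws set S -> R^o} => charge_integral p phi : R^o).
Proof.
move=> sphi; pose K := {ptws set S -> R^o}.
pose F x (p : K) : R^o := x * p (phi @^-1` [set x]).
have Fc x : continuous (F x).
  move=> p; apply: (@continuous_comp K R^o R^o (fun q => q _) ( *%R x)).
    exact: (@proj_continuous (set S) (fun _ => R^o)).
  exact: mulrl_continuous.
have -> : (fun p : K => charge_integral p phi : R^o) =
    (fun p : K => \sum_(x <- fset_set (range phi)) F x p).
  (* The support over which the defining sum runs varies with [p]; the list [fset_set (range phi)]
     does not, which permits the induction on it. *)
  by apply/funext => p; rewrite charge_integralE.
elim: (fset_set (range phi) : seq R) => [|x r IH].
  rewrite (_ : (fun _ : K => _) = cst 0); first exact: cst_continuous.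
  by apply/funext => p; rewrite big_nil.
rewrite (_ : (fun _ : K => _) = F x + (fun p => \sum_(x <- r) F x p)).
  by move=> p; apply: continuousD; [exact: Fc|exact: IH].
by apply/funext => p; rewrite big_cons.
Qed.

Lemma continuous_to_prod (T : topologicalType) (I : Type)
    (K : I -> topologicalType) (f : T -> prod_topology K) :
  (forall i, continuous (fun x => f x i)) -> continuous f.
Proof.
move=> fc x; apply/cvg_sup => i; move: x.
exact: (@continuous_comp_initial _ _ _ (fun g : forall i, K i => g i) f).
Qed.

(** By the universal properties of initial and product topologies, pointwise continuity of each
    integral suffices. Hence pointwise compact sets are weak* compact. *)
Lemma continuous_ptws_weak_star (R : realType) d (S : algebraOfSetsType d) :
  continuous (idfun : {ptws set S -> R^o} -> @weak_star d S R).
Proof.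
pose K := {ptws set S -> R^o}.
apply: (@continuous_comp_initial _ K _ (@charge_integral_on_B0 d S R) idfun).
apply: continuous_to_prod => i.
exact: (charge_integral_ptws_continuous (set_mem (valP i))).
Qed.

(** Together with nonnegativity this places [Delta] in a cube of functions into [[0, 1]]. Outside
    the algebra the bound comes from the default value 0. *)
Lemma charge_le1 (R : realType) d (S : algebraOfSetsType d)
    (p : set S -> R^o) (A : set S) : Delta p -> p A <= 1 :> R.
Proof.
move=> [p0 p1 pD pN]; have [mA|/pN ->] := pselect (measurable A) => //.
rewrite -p1 -(setUv A) pD//; first by rewrite lerDl.
- exact: measurableC.
- by rewrite setICr.
Qed.

(** Each defining condition of a charge is an intersection of closed conditions on finitely many
    evaluations, which are continuous projections. *)
Lemma closed_Delta (R : realType) d (S : algebraOfSetsType d) :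
  closed (@Delta d S R : set {ptws set S -> R^o}).
Proof.
pose K := {ptws set S -> R^o}.
have pc A : continuous (fun p : K => p A : R^o).
  exact: (@proj_continuous (set S) (fun _ => R^o)).
have eqc (f g : K -> R^o) : continuous f -> continuous g ->
    closed [set p | f p = g p].
  move=> cf cg; pose h p : R^o := f p - g p.
  have hc : continuous h.
    move=> p; apply: (@continuousB _ R^o K f g p); [exact: cf|exact: cg].
  rewrite (_ : mkset _ = h @^-1` [set x | x = 0]).
    exact: (iffLR (continuous_closedP h) hc _ (@closed_eq R 0)).
  apply/seteqP; split=> p; rewrite /= /h.
    by move=> ->; rewrite subrr.
  by move=> /eqP; rewrite subr_eq0 => /eqP.
have -> : @Delta d S R = 
   [set p : K | forall A, 0 <= p A :> R] `&` [set p : K | p [set: S] = 1] `&`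
   [set p : K | forall A B, measurable A -> measurable B -> A `&` B = set0 ->
      p (A `|` B) = p A + p B] `&`
   [set p : K | forall A, ~ measurable A -> p A = 0].
  by apply/seteqP; split=> p; [case|case=> [[[]]]].
apply: closedI; last first.
  rewrite (_ : mkset _ =
    \bigcap_(A in [set A | ~ measurable A]) [set p : K | p A = 0])//.
  by apply: closed_bigI => A _; apply: eqc => //; exact: cst_continuous.
apply: closedI; last first.
  rewrite (_ : mkset _ = \bigcap_(AB in [set AB : set S * set S |
    [/\ measurable AB.1, measurable AB.2 & AB.1 `&` AB.2 = set0]])
    [set p : K | p (AB.1 `|` AB.2) = p AB.1 + p AB.2]).
    apply: closed_bigI => AB _; apply: eqc => // p.
    by apply: (@continuousD _ _ K); exact: pc.
  apply/seteqP; split=> p /= H; first by move=> AB [? ? ?]; exact: H.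
  by move=> A B mA mB AB; apply: (H (A, B)).
apply: closedI; last by apply: eqc => //; exact: cst_continuous.
rewrite (_ : mkset _ = \bigcap_A [set p : K | 0 <= p A :> R]).
  apply: closed_bigI => A _.
  exact: (iffLR (continuous_closedP _) (pc A) _ (@closed_ge R 0)).
by apply/seteqP; split=> p /= H => [A _|A]; [exact: H|exact: (H A)].
Qed.

(** In the pointwise topology the set is closed inside a cube that is compact by Tychonoff's
    theorem; the continuous identity map then carries compactness to the weak* topology. *)
Lemma compact_sublevel (R : realType) d (S : algebraOfSetsType d)
    (phi : S -> R) (c : R) : simple phi ->
  @compact weak_star ([set p | Delta p /\ charge_integral p phi <= c]).
Proof.
move=> sphi; pose K := {ptws set S -> R^o}.
set Q := [set p | _].
suff cQ : compact (Q : set K).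
  have idc := continuous_subspaceT (@continuous_ptws_weak_star R d S).
  have := continuous_compact (idc _) cQ.
  by rewrite image_id.
pose I : set R^o := [set` `[0 : R, 1]].
have cI : compact [set p : K | forall A, I (p A)].
  have := @tychonoff (set S) (fun _ => R^o) (fun _ => I).
  by apply=> A; exact: segment_compact.
apply: subclosed_compact cI _; last first.
  move=> p [Dp _] A; rewrite /I/= in_itv/= charge_le1// andbT.
  by case: Dp.
rewrite (_ : Q = Delta `&` (charge_integral ^~ phi) @^-1` [set x | x <= c])//.
apply: closedI; first exact: closed_Delta.
have intc := charge_integral_ptws_continuous sphi.
exact: (iffLR (continuous_closedP _) intc _ (@closed_le R c)).
Qed.

Lemma convex_sublevel (R : realType) d (S : algebraOfSetsType d)
    (phi : S -> R) (c : R) : simple phi ->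
  convex_set [set p : set S -> R^o | Delta p /\ charge_integral p phi <= c].
Proof.
move=> sphi p q t /set_mem[Dp pc] /set_mem[Dq qc]; apply/mem_set.
pose a : R := t%:num; have a0 : 0 <= a by rewrite /a.
have a1 : 0 <= 1 - a by rewrite subr_ge0 /a.
have [p0 p1 pD pN] := Dp; have [q0 q1 qD qN] := Dq.
have tE A : (conv t p q : set S -> R^o) A = a * p A + (1 - a) * q A by [].
split.
  split=> [A||A B mA mB AB|A nA]; rewrite !tE.
  - by rewrite addr_ge0// mulr_ge0.
  - by rewrite p1 q1; ring.
  - by rewrite pD// qD//; ring.
  - by rewrite pN// qN//; ring.
have -> : charge_integral (conv t p q : set S -> R^o) phi =
    a * charge_integral p phi + (1 - a) * charge_integral q phi.
  rewrite !charge_integralE// !mulr_sumr -big_split/=.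
  by apply: eq_bigr => x _; rewrite tE; ring.
have -> : c = a * c + (1 - a) * c by ring.
by rewrite lerD// ler_wpM2l.
Qed.

Lemma charge_integrals_has_min (R : realType) d (S : algebraOfSetsType d)
    (P : set (set S -> R^o)) (phi : S -> R) :
  convex_compact P -> simple phi -> exists m, is_min (charge_integrals P phi) m.
Proof.
move=> [_ P0 _ cP] sphi.
exact: (@compact_has_min weak_star R _ P P0 cP
  (charge_integral_continuous sphi)).
Qed.

Lemma charge_integrals_has_max (R : realType) d (S : algebraOfSetsType d)
    (P : set (set S -> R^o)) (phi : S -> R) :
  convex_compact P -> simple phi -> exists m, is_max (charge_integrals P phi) m.
Proof.
move=> [_ P0 _ cP] sphi.
exact: (@compact_has_max weak_star R _ P P0 cP
  (charge_integral_continuous sphi)).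
Qed.

(** * Renormalized utilities and the ranking of constants against acts *)

Lemma pos_affine_equiv_le (R : realType) (E : lmodType R) (X : set E)
    (u v : E -> R) (x y : E) :
  pos_affine_equiv X u v -> X x -> X y -> (u x <= u y) = (v x <= v y).
Proof.
move=> [a [b [a0 uv]]] Xx Xy.
by rewrite (uv _ Xx) (uv _ Xy) lerD2r ler_pM2l.
Qed.

Lemma pos_affine_equiv_refl (R : realType) (E : lmodType R) (X : set E)
    (u : E -> R) : pos_affine_equiv X u u.
Proof. by exists 1, 0; split=> // x _; rewrite mul1r addr0. Qed.

Lemma pos_affine_equiv_sym (R : realType) (E : lmodType R) (X : set E)
    (u v : E -> R) : pos_affine_equiv X u v -> pos_affine_equiv X v u.
Proof.
move=> [a [b [a0 uv]]]; exists a^-1, (- a^-1 * b).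
split=> [|x Xx]; first by rewrite invr_gt0.
by rewrite uv//; field; exact: lt0r_neq0.
Qed.

Lemma pref_cst_certainty_equivalent (R : realType) d (S : algebraOfSetsType d)
    (E : lmodType R) (X : set E) (pref : (S -> E) -> (S -> E) -> Prop)
    (u : E -> R) (f : S -> E) (x c : E) :
  weak_order X pref -> utility_index X pref u -> act X f -> X x -> X c ->
  indiff pref (cst c) f -> pref (cst x) f <-> u c <= u x.
Proof.
move=> WO U af Xx Xc [cf fc]; rewrite -(pref_cst WO U Xx Xc).
have [_ _ tr] := WO; have [ax ac] := (act_cst S Xx, act_cst S Xc).
split=> [xf|xc]; first exact: (tr _ _ _ ax af ac xf).
exact: (tr _ _ _ ax ac af xc).
Qed.

Lemma simple_utility (R : realType) d (S : algebraOfSetsType d)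
    (E : lmodType R) (X : set E) (u : E -> R) (f : S -> E) :
  act X f -> simple (u \o f).
Proof. by move=> [sf _]; exact: simple_comp. Qed.

(** * Ambiguity aversion through certainty equivalents, and extremal members of the two families *)

Section comparison.
Context (R : realType) (d : measure_display) (S : algebraOfSetsType d)
  (E : lmodType R) (X : set E).
Implicit Types (pref : (S -> E) -> (S -> E) -> Prop) (u : E -> R).

(** Applied to constant acts, the comparison says that the order of [u2] on [X] implies that of
    [u1]. *)
Lemma more_averse_pos_affine pref1 pref2 u1 u2 :
  convex_set X -> weak_order X pref1 -> weak_order X pref2 ->
  utility_index X pref1 u1 -> utility_index X pref2 u2 ->
  more_ambiguity_averse X pref1 pref2 -> pos_affine_equiv X u1 u2.
Proof.
move=> cX W1 W2 U1 U2 maa; have [[au1 n1 _] [au2 _ _]] := (U1, U2).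
apply: order_preserving_affine => // a b Xa Xb.
move=> /(pref_cst W2 U2 Xa Xb) /(maa _ _ (act_cst S Xb) Xa).
by move=> /(pref_cst W1 U1 Xa Xb).
Qed.

(** The constant [c2] is weakly preferred to [f] by [pref2], hence by [pref1], which ranks [f] with
    [c1]. The third index [u] stands for any common normalization. *)
Lemma certainty_equivalent_le pref1 pref2 u1 u2 u f c1 c2 :
  weak_order X pref1 -> weak_order X pref2 ->
  utility_index X pref1 u1 -> utility_index X pref2 u2 ->
  pos_affine_equiv X u u1 -> more_ambiguity_averse X pref1 pref2 ->
  act X f -> X c1 -> X c2 ->
  indiff pref1 (cst c1) f -> indiff pref2 (cst c2) f -> u c1 <= u c2.
Proof.
move=> W1 W2 U1 U2 uu1 maa af X1 X2 i1 [p2 _].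
rewrite (pos_affine_equiv_le uu1)//.
apply/(pref_cst_certainty_equivalent W1 U1 af X2 X1 i1).
exact: maa.
Qed.

Lemma more_averse_of_le pref1 pref2 u1 u2 u :
  convex_set X ->
  weak_order X pref1 -> weak_order X pref2 ->
  monotone_pref X pref1 -> monotone_pref X pref2 ->
  utility_index X pref1 u1 -> utility_index X pref2 u2 ->
  pos_affine_equiv X u u1 -> pos_affine_equiv X u u2 ->
  (forall f c1 c2, act X f -> X c1 -> X c2 ->
    indiff pref1 (cst c1) f -> indiff pref2 (cst c2) f -> u c1 <= u c2) ->
  more_ambiguity_averse X pref1 pref2.
Proof.
move=> cX W1 W2 M1 M2 U1 U2 uu1 uu2 cle f x af Xx.
have [c1 X1 i1] := certainty_equivalent_exists cX W1 M1 U1 af.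
have [c2 X2 i2] := certainty_equivalent_exists cX W2 M2 U2 af.
move=> /(pref_cst_certainty_equivalent W2 U2 af Xx X2 i2).
rewrite -(pos_affine_equiv_le uu2)// => c2x.
apply/(pref_cst_certainty_equivalent W1 U1 af Xx X1 i1).
by rewrite -(pos_affine_equiv_le uu1)// (le_trans (cle _ _ _ af X1 X2 i1 i2)).
Qed.

(** Every member of a max-min family is in [Pstar], because its least integral for any act is at
    most the max-min value; it remains to pick a member optimal for [f]. *)
Lemma Pstar_attains pref u f c :
  weak_order X pref -> utility_index X pref u ->
  act X f -> X c -> indiff pref (cst c) f ->
  exists2 P, Pstar X pref u P & is_min (charge_integrals P (u \o f)) (u c).
Proof.
move=> WO U af Xc cf.
have [PP PPc mm] := maxmin_certainty_equivalent WO U.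
have [[P PPP minP] _] := mm _ _ af Xc cf.
exists P => //; split=> [|g y ag Xy yg]; first exact: PPc.
have [m mP] := charge_integrals_has_min (PPc _ PPP) (simple_utility u ag).
by exists m => //; have [_] := mm _ _ ag Xy yg; apply; exists P.
Qed.

(** An upper bound is enough here: membership in [Qstar], tested on [f] itself, gives the reverse
    inequality. *)
Lemma Qstar_attains pref u f c :
  weak_order X pref -> utility_index X pref u ->
  act X f -> X c -> indiff pref (cst c) f ->
  exists2 Q, Qstar X pref u Q & ubound (charge_integrals Q (u \o f)) (u c).
Proof.
move=> WO U af Xc cf.
have [PP PPc mm] := maxmin_certainty_equivalent WO U.
have sf := simple_utility u af.
pose Q := [set p : set S -> R^o | Delta p /\ charge_integral p (u \o f) <= u c].
(* A charge minimizing the integral of [u \o f] over [P] lies in [Q], since that minimum is at most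
   the max-min value [u c]. *)
have meet P : PP P -> exists2 p, P p & Q p.
  move=> PPP; have [m mP] := charge_integrals_has_min (PPc _ PPP) sf.
  have mc : m <= u c by have [_] := mm _ _ af Xc cf; apply; exists P.
  have [[p Pp pm] _] := mP; exists p => //; split; last by rewrite pm.
  by have [PD _ _ _] := PPc _ PPP; exact: PD.
have cQ : convex_compact Q.
  split.
  - by move=> p [].
  - have [[P /meet[p _ Qp] _] _] := mm _ _ af Xc cf; by exists p.
  - exact: convex_sublevel.
  - exact: compact_sublevel.
exists Q; last by move=> _ [p [_ ple] <-].
split=> // g y ag Xy yg.
have [m mQ] := charge_integrals_has_max cQ (simple_utility u ag).
exists m => //.
(* Take [P] optimal for [g]. A charge common to [P] and [Q] integrates [u \o g] to at least the
   minimum over [P], which is [u y], and to at most the maximum [m] over [Q]. *)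
have [[P /meet[p Pp Qp] [_ minP]] _] := mm _ _ ag Xy yg.
apply: (@le_trans _ _ (charge_integral p (u \o g))).
  by apply: minP; exists p.
by case: mQ => _; apply; exists p.
Qed.

End comparison.

Theorem proposition6p3 (R : realType) (d : measure_display)
  (S : algebraOfSetsType d) (E : lmodType R) (X : set E)
  (X_nonempty : X !=set0) (X_convex : convex_set X)
  (pref1 pref2 : (S -> E) -> (S -> E) -> Prop)
  (IB1 : invariant_biseparable X pref1) (IB2 : invariant_biseparable X pref2)
  (u1 u2 : E -> R)
  (U1 : utility_index X pref1 u1) (U2 : utility_index X pref2 u2) :
  (more_ambiguity_averse X pref1 pref2 <->
     pos_affine_equiv X u1 u2 /\
     forall u : E -> R, pos_affine_equiv X u u1 -> pos_affine_equiv X u u2 ->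
       Pstar X pref1 u `<=` Pstar X pref2 u)
  /\
  (more_ambiguity_averse X pref1 pref2 <->
     pos_affine_equiv X u1 u2 /\
     forall u : E -> R, pos_affine_equiv X u u1 -> pos_affine_equiv X u u2 ->
       Qstar X pref2 u `<=` Qstar X pref1 u).
Proof.
have [[W1 M1 _ _] [W2 M2 _ _]] := (IB1, IB2).
split; split.
- move=> maa; split; first exact: more_averse_pos_affine U1 U2 maa.
  move=> u uu1 uu2 P [cP minP]; split=> // f x2 af X2 i2.
  have [x1 X1 i1] := certainty_equivalent_exists X_convex W1 M1 U1 af.
  have [m mP mx1] := minP _ _ af X1 i1; exists m => //.
  apply: le_trans mx1 _.
  exact: certainty_equivalent_le W1 W2 U1 U2 uu1 maa af X1 X2 i1 i2.
- move=> [u12 /(_ _ (pos_affine_equiv_refl X u1) u12) sub].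
  apply: (more_averse_of_le X_convex W1 W2 M1 M2 U1 U2
    (pos_affine_equiv_refl X u1) u12) => f c1 c2 af X1 X2 i1 i2.
  (* A set whose least integral for [f] is exactly [u1 c1] also belongs to the second family, which
     caps that integral at [u1 c2]. *)
  have [P /sub[_ minP] mP] := Pstar_attains W1 U1 af X1 i1.
  by have [m mP' mc2] := minP _ _ af X2 i2; rewrite (is_min_unique mP mP').
- move=> maa; split; first exact: more_averse_pos_affine U1 U2 maa.
  move=> u uu1 uu2 Q [cQ maxQ]; split=> // f x1 af X1 i1.
  have [x2 X2 i2] := certainty_equivalent_exists X_convex W2 M2 U2 af.
  have [m mQ mx2] := maxQ _ _ af X2 i2; exists m => //.
  apply: le_trans _ mx2.
  exact: certainty_equivalent_le W1 W2 U1 U2 uu1 maa af X1 X2 i1 i2.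
- move=> [u12]; have u21 := pos_affine_equiv_sym u12.
  (* The normalization is now [u2], because the extremal set comes from [pref2]: its integrals for
     [f] are at most [u2 c2], while membership in the family of [pref1] makes one of them at least
     [u2 c1]. *)
  move=> /(_ _ u21 (pos_affine_equiv_refl X u2)) sub.
  apply: (more_averse_of_le X_convex W1 W2 M1 M2 U1 U2 u21
    (pos_affine_equiv_refl X u2)) => f c1 c2 af X1 X2 i1 i2.
  have [Q /sub[_ maxQ] Qc2] := Qstar_attains W2 U2 af X2 i2.
  have [m [Qm _] c1m] := maxQ _ _ af X1 i1.
  exact: le_trans c1m (Qc2 _ Qm).
Qed.
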